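(* Let $p$ be an odd prime, $n=rk$ with $k>1$, $f:\mathbb{F}_{p^n}\to\mathbb{F}_{p^k}$, and let $\gamma\in\mathbb{F}_{p^n}^*$ be a $b$-linear translator of $f$ with $b\in\mathbb{F}_{p^k}$, $b\neq0$. Let $\lambda\in\mathbb{F}_{p^k}^*$ with $\lambda\neq-b^{-1}$. Then the function $$F(x)=x+\gamma\lambda f(x)$$ permutes $\mathbb{F}_{p^n}$. Moreover, if $\lambda=-2b^{-1}$ then $F$ is an involution.
   Context: For $f:\mathbb{F}_{p^n}\to\mathbb{F}_{p^k}$ with $k\mid n$, $\gamma\in\mathbb{F}_{p^n}^*$ and $b\in\mathbb{F}_{p^k}$, $\gamma$ is a $b$-linear translator of $f$ if $f(x+u\gamma)-f(x)=ub$ for all $x\in\mathbb{F}_{p^n}$ and all $u\in\mathbb{F}_{p^k}$. An involution is a map with $F\circ F=\mathrm{id}$. *)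

(* Defs.v *)
From mathcomp Require Import all_boot all_order all_algebra.

Set Implicit Arguments.
Unset Strict Implicit.
Unset Printing Implicit Defensive.

Import GRing.Theory.
Local Open Scope ring_scope.

(* The inclusion of the subfield F_{p^k} into F_{p^n} is rendered by a ring   *)
(* morphism iota : K -> L between finite fields (injective since K is a       *)
(* field); the values f x, the increments u and the constant b all live in K. *)
Definition linear_translator (K L : finFieldType) (iota : {rmorphism K -> L})
    (f : L -> K) (gamma : L) (b : K) : Prop :=
  forall (x : L) (u : K), f (x + iota u * gamma) - f x = u * b.

(* Main.v *)
(* Translating along gamma multiplies f by a scalar: f (F x) = (1 + lambda b) f x.
   If lambda <> - b^-1 the scalar is nonzero, so F x determines f x and then x;
   if lambda = - 2 b^-1 the scalar is -1, so the second translation undoes the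
   first. *)

Require Import Defs.
From mathcomp Require Import all_boot all_order all_algebra.

Import GRing.Theory.
Local Open Scope ring_scope.

(** The shift is [iota u * gamma] for [u = lambda * f x] in [K], so the translator property adds
    [u * b] to [f x]. *)
Lemma linear_translator_comp (K L : finFieldType) (iota : {rmorphism K -> L})
    (f : L -> K) (gamma : L) (b lambda : K) (x : L) :
  linear_translator iota f gamma b ->
  f (x + gamma * iota lambda * iota (f x)) = (1 + lambda * b) * f x.
Proof.
move=> transl; rewrite -mulrA -rmorphM mulrC.
move/eqP: (transl x (lambda * f x)); rewrite subr_eq => /eqP ->.
by rewrite mulrDl mul1r addrC mulrAC.
Qed.

Theorem proposition5 (p n r k : nat) (p_prime : prime p) (p_odd : odd p)
    (n_eq : n = (r * k)%N) (k_gt1 : (1 < k)%N)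
    (K L : finFieldType) (iota : {rmorphism K -> L})
    (cardK : #|K| = (p ^ k)%N) (cardL : #|L| = (p ^ n)%N)
    (f : L -> K) (gamma : L) (gamma_neq0 : gamma != 0)
    (b : K) (b_neq0 : b != 0)
    (gamma_transl : linear_translator iota f gamma b)
    (lambda : K) (lambda_neq0 : lambda != 0) (lambda_neq : lambda != - b^-1) :
  let F := fun x : L => x + gamma * iota lambda * iota (f x) in
  bijective F /\ (lambda = - 2 * b^-1 -> involutive F).
Proof.
move=> F.
have fF x : f (F x) = (1 + lambda * b) * f x.
  exact: linear_translator_comp.
split.
  have scal_neq0 : 1 + lambda * b != 0.
    apply: contra lambda_neq; rewrite addrC addr_eq0 => /eqP lambda_b.
    by rewrite -[lambda](mulfK b_neq0) lambda_b mulN1r.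
  (* As [L] is finite, injectivity suffices; once [f x = f y], both shifts coincide and cancel. *)
  apply: injF_bij => x y eqF.
  have eqf : f x = f y by apply: (mulfI scal_neq0); rewrite -!fF eqF.
  by move: eqF; rewrite /F eqf => /addIr.
move=> lambdaE x.
have fFN : f (F x) = - f x.
  by rewrite fF lambdaE mulfVK // -[2]/(1 + 1) opprD addrA subrr add0r mulN1r.
(* Only the outer [F] is unfolded at first: its shift at [F x] is the opposite of the shift at
   [x]. *)
by rewrite {1}/F fFN rmorphN mulrN /F addrK.
Qed.
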